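(* For every real $\varepsilon>0$ there exists $N$ (depending on $\varepsilon$) such that for every integer $n\geq N$ and every prime power $q$ with $q\geq n(\log n)^{1+\varepsilon}$, the relation algebra $\mathfrak{L}(q,n)$ is representable, i.e. $\mathfrak{L}(q,n)\in\mathsf{RRA}$. In particular, for every integer $n\geq 18$ and every prime power $q$ with $q\geq n(\log n)^{3}$, $\mathfrak{L}(q,n)\in\mathsf{RRA}$.
   Context: Here $\log$ denotes the natural logarithm. Notation: in a relation algebra, $+$ denotes Boolean join, $\cdot$ denotes Boolean meet, $\overline{x}$ denotes the Boolean complement of $x$, $;$ denotes relative multiplication (composition), and $1'$ denotes the identity element. A relation algebra is symmetric if the converse of every element is the element itself, and integral if $1'$ is an atom. Definition of $\mathfrak{L}(q,n)$: let $q$ be a positive integer and $n$ a nonnegative integer. $\mathfrak{L}(q,n)$ is the (finite) symmetric integral relation algebra whose Boolean reduct is the finite Boolean algebra with the distinct atoms $1', a_0,\dots,a_q, t_1,\dots,t_n$, where $1'$ is the identity element for $;$. Write $A=a_0+\cdots+a_q$ and $T=t_1+\cdots+t_n$. The operation $;$ is commutative, distributes over joins in each argument, and is determined on atoms as follows: for $0\leq i,j\leq q$ with $i\neq j$, and $1\leq k,l\leq n$ with $k\neq l$, \begin{align*} a_i ; a_i &= 1'+a_i,\\ a_i ; a_j &= A\cdot\overline{a_i+a_j},\\ a_i ; t_k &= T,\\ t_k ; t_k &= 1'+A,\\ t_k ; t_l &= A. \end{align*} $\mathsf{RRA}$ is the class of representable relation algebras: a relation algebra is representable if it is isomorphic to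 an algebra of binary relations on some set $U$ whose top element is an equivalence relation $E$ on $U$, with the Boolean operations interpreted as union, intersection and complement relative to $E$, with $;$ interpreted as composition of relations, converse as the converse of relations, and the identity element as the identity relation on $U$. *)

(* Defs.v *)
From HB Require Import structures.
From mathcomp Require Import all_boot all_order.
From mathcomp Require Import boolp classical_sets functions.

Set Implicit Arguments.
Unset Strict Implicit.
Unset Printing Implicit Defensive.

Import Order.TTheory.
(* makes [{set T}] the Boolean algebra of the subsets of [T] *)
Import Order.DefaultSetSubsetOrder.

(* Boolean algebras are the library's [ctbDistrLatticeType]s: Boolean join,
   meet and complement are [`|`], [`&`] and [~`]. *)
Record relalg_signature := RelalgSignature {
  ra_disp : Order.disp_t;
  ra_carrier :> ctbDistrLatticeType ra_disp;
  ra_comp : ra_carrier -> ra_carrier -> ra_carrier;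
  ra_conv : ra_carrier -> ra_carrier;
  ra_id : ra_carrier
}.

Arguments ra_comp {r} _ _.
Arguments ra_conv {r} _.
Arguments ra_id {r}.

(* Tarski's axioms; the Boolean ones are built into the carrier. *)
Record relation_algebra (L : relalg_signature) : Prop := RelationAlgebra {
  ra_compA : forall x y z : L,
    ra_comp (ra_comp x y) z = ra_comp x (ra_comp y z);
  ra_compUl : forall x y z : L,
    ra_comp (x `|` y)%O z = (ra_comp x z `|` ra_comp y z)%O;
  ra_comp1 : forall x : L, ra_comp x ra_id = x;
  ra_convK : forall x : L, ra_conv (ra_conv x) = x;
  ra_convU : forall x y : L, ra_conv (x `|` y)%O = (ra_conv x `|` ra_conv y)%O;
  ra_convM : forall x y : L,
    ra_conv (ra_comp x y) = ra_comp (ra_conv y) (ra_conv x);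
  ra_tarski : forall x y : L,
    (ra_comp (ra_conv x) (~` ra_comp x y) <= ~` y)%O
}.

Local Open Scope classical_set_scope.

(* Composition is in diagrammatic order; the library's [R \; S] from
   [relation_scope] is in the opposite order. *)
Definition rel_comp (U : Type) (R S : set (U * U)) : set (U * U) :=
  [set xy | exists2 z, R (xy.1, z) & S (z, xy.2)].

Definition rel_conv (U : Type) (R : set (U * U)) : set (U * U) :=
  [set xy | R (xy.2, xy.1)].

(* [C] is (the universe of) an algebra of binary relations on [U] with top [E]. *)
Record algebra_of_relations (U : Type) (E : set (U * U))
    (C : set (set (U * U))) : Prop := AlgebraOfRelations {
  aor_equiv : RelationClasses.Equivalence (fun x y : U => E (x, y));
  aor_sub : forall R, C R -> R `<=` E;
  aor_top : C E;
  aor_union : forall R S, C R -> C S -> C (R `|` S);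
  aor_inter : forall R S, C R -> C S -> C (R `&` S);
  aor_compl : forall R, C R -> C (E `\` R);
  aor_comp : forall R S, C R -> C S -> C (rel_comp R S);
  aor_conv : forall R, C R -> C (rel_conv R);
  aor_id : C diagonal
}.

Record isomorphism_onto (L : relalg_signature) (U : Type) (E : set (U * U))
    (C : set (set (U * U))) (h : L -> set (U * U)) : Prop := IsomorphismOnto {
  iso_bij : set_bij [set: L] C h;
  iso_join : forall x y : L, h (x `|` y)%O = h x `|` h y;
  iso_meet : forall x y : L, h (x `&` y)%O = h x `&` h y;
  iso_compl : forall x : L, h (~` x)%O = E `\` h x;
  iso_comp : forall x y : L, h (ra_comp x y) = rel_comp (h x) (h y);
  iso_conv : forall x : L, h (ra_conv x) = rel_conv (h x);
  iso_id : h ra_id = diagonal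
}.

Definition RRA (L : relalg_signature) : Prop :=
  relation_algebra L /\
  exists (U : Type) (E : set (U * U)) (C : set (set (U * U))),
    algebra_of_relations E C /\ exists h : L -> set (U * U), isomorphism_onto E C h.

Local Close Scope classical_set_scope.

Section LyndonLike.
Variables q n : nat.

Inductive latom := AId | Aa of 'I_q.+1 | At of 'I_n.

Definition latom_enc (x : latom) : option ('I_q.+1 + 'I_n) :=
  match x with AId => None | Aa i => Some (inl i) | At k => Some (inr k) end.

Definition latom_dec (x : option ('I_q.+1 + 'I_n)) : latom :=
  match x with None => AId | Some (inl i) => Aa i | Some (inr k) => At k end.

Lemma latom_encK : cancel latom_enc latom_dec.
Proof. by case. Qed.

HB.instance Definition _ := Finite.copy latom (can_type latom_encK).

Definition lA : {set latom} := [set Aa i | i : 'I_q.+1].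
Definition lT : {set latom} := [set At k | k : 'I_n].

Definition latom_comp (x y : latom) : {set latom} :=
  match x, y with
  | AId, z | z, AId => [set z]
  | Aa i, Aa j =>
      if i == j then [set AId; Aa i] else lA :&: ~: [set Aa i; Aa j]
  | Aa _, At _ | At _, Aa _ => lT
  | At k, At l => if k == l then AId |: lA else lA
  end.

Definition lcomp (X Y : {set latom}) : {set latom} :=
  \bigcup_(x in X) \bigcup_(y in Y) latom_comp x y.

Lemma lcomp_atoms (x y : latom) : lcomp [set x] [set y] = latom_comp x y.
Proof. by rewrite /lcomp !big_set1. Qed.

(* For [q = 1] and [q = 2] the composition is not associative; [RRA] includes the
   relation algebra axioms. *)
Definition Lqn : relalg_signature :=
  @RelalgSignature _ {set latom} lcomp id [set AId].

End LyndonLike.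

Definition prime_power (q : nat) : Prop :=
  exists p k : nat, [/\ prime p, 0 < k & q = p ^ k].

(* Main.v *)
Require Import Defs.
From HB Require Import structures.
From mathcomp Require Import all_classical all_reals all_analysis.
From mathcomp Require Import all_boot all_order all_algebra finfield.
From mathcomp Require Import ring lra zify.

Import Order.TTheory GRing.Theory Num.Theory.
Local Open Scope ring_scope.

Set Implicit Arguments.
Unset Strict Implicit.
Unset Printing Implicit Defensive.

(** Take two disjoint copies of the affine plane over the field [F] with [q]
    elements, and a colouring [f] of [F * F] by [n] colours.  Label a pair of
    distinct points of one copy by [a_i], where [i] is the direction of the
    line through them ([q + 1] directions), and a pair [x], [y] of points of
    different copies by [t_k], where [k = f (x + y)].  Such a labelling
    represents the algebra as soon as every entry of the composition table is
    realised exactly ([labelled_RRA]).  The rule for two atoms [a_i], [a_j] is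
    plane geometry, the parity of the number of changes of copy takes care of
    the shape of the other rules, and two conditions on [f] remain
    ([plane_RRA]):
    - for [a_i ; t_k]: on every line with one point removed, [f] takes every
      value;
    - for [t_k ; t_l]: for every [d != 0] and all colours [k], [l] there is a
      point [w] with [f w = k] and [f (w + d) = l].

    Because the colour of [(x, y)] depends on [x + y] only, there are few
    conditions, and a plain union bound over a uniformly random [f] is enough.
    A given colour misses a given punctured line with probability
    [(1 - 1/n)^(q-1)].  A given translation and pair of colours fails with
    probability at most [(1 - 1/n^2)^m] for some [m >= q^2/3], since among
    the pairs [(w, w + d)] there are that many disjoint ones
    ([large_disjoint_image]).  Summing over the [q^2 (q+1) n] conditions of the
    first kind and at most [q^2 n^2] of the second, a good colouring exists
    when [2 n q^3 exp(- q/n) < 1] ([RRA_of_small_failure]).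

    With [s = q/n] this follows from [1 + 4 ln n + 3 ln s < s]
    ([RRA_of_log_ineq]).  If [s >= (ln n)^(1 + eps)] and [n] is large, [s]
    is at least [8 ln n] and exceeds [6 ln s + 2].  If [s >= (ln n)^3] and [n >= 18], the
    cube root [r] of [s] is at least [ln n >= 2.8]; then [4 ln n <= 4 r] and
    [3 ln s = 9 ln r <= 9 r/e], and [1 + (4 + 9/e) r < r^3] holds from [2.8]
    on, with little to spare. *)

(** * Representations from labellings of pairs of points *)

Section Labelling.
Variables (q n : nat) (U : Type) (lab : U -> U -> latom q n).
Hypothesis lab_id : forall u v, lab u v = AId q n <-> u = v.
Hypothesis lab_sym : forall u v, lab u v = lab v u.
Hypothesis lab_onto : forall a, exists u v, lab u v = a.
Hypothesis lab_comp : forall a b u v,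
  (lab u v \in latom_comp a b) <-> exists2 w, lab u w = a & lab w v = b.

Definition lab_rel (X : {set latom q n}) : set (U * U) :=
  [set xy | lab xy.1 xy.2 \in X]%classic.

Lemma lab_rel_inj : injective lab_rel.
Proof.
move=> X Y eXY; apply/setP => a; have [u [v <-]] := lab_onto a.
have := congr1 (fun E : set (U * U) => E (u, v)) eXY.
by rewrite /lab_rel /= => e; apply/idP/idP; rewrite e.
Qed.

Lemma lab_relU X Y : lab_rel (X :|: Y) = (lab_rel X `|` lab_rel Y)%classic.
Proof.
rewrite predeqE => -[u v]; rewrite /lab_rel /= in_setU.
by split=> [/orP|/orP].
Qed.

Lemma lab_relI X Y : lab_rel (X :&: Y) = (lab_rel X `&` lab_rel Y)%classic.
Proof.
rewrite predeqE => -[u v]; rewrite /lab_rel /= in_setI.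
by split=> [/andP|/andP].
Qed.

Lemma lab_relC X : lab_rel (~: X) = (classical_sets.setT `\` lab_rel X)%classic.
Proof.
rewrite predeqE => -[u v]; rewrite /lab_rel /= in_setC.
by split=> [/negP|[_ /negP]].
Qed.

Lemma lab_rel_comp X Y : lab_rel (lcomp X Y) = rel_comp (lab_rel X) (lab_rel Y).
Proof.
rewrite predeqE => -[u v]; rewrite /lab_rel /rel_comp /=; split.
  move=> /bigcupP[a aX /bigcupP[b bY /lab_comp[w ea eb]]].
  by exists w; rewrite ?ea ?eb.
move=> [w uw wv]; apply/bigcupP; exists (lab u w) => //.
by apply/bigcupP; exists (lab w v) => //; apply/lab_comp; exists w.
Qed.

Lemma lab_rel_conv X : rel_conv (lab_rel X) = lab_rel X.
Proof. by rewrite predeqE => -[u v]; rewrite /lab_rel /rel_conv /= lab_sym. Qed.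

Lemma lab_rel_id : lab_rel [set AId q n] = diagonal.
Proof.
rewrite predeqE => -[u v]; rewrite /lab_rel /diagonal /= in_set1.
by split=> [/eqP/lab_id|/lab_id/eqP].
Qed.

Let L := Lqn q n.

Lemma lcompC X Y : lcomp X Y = lcomp Y X :> {set latom q n}.
Proof.
apply: lab_rel_inj; rewrite -lab_rel_conv !lab_rel_comp.
rewrite predeqE => -[u v]; rewrite /rel_conv /rel_comp /lab_rel /=.
by split=> -[w uw wv]; exists w; rewrite lab_sym.
Qed.

(** Sets of pairs satisfy the relation algebra axioms, and [lab_rel] is an
    embedding, so no inspection of the composition table is needed. *)
Lemma labelled_relation_algebra : relation_algebra L.
Proof.
split; rewrite /L /=.
- move=> x y z; apply: lab_rel_inj; rewrite !lab_rel_comp predeqE => -[u v].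
  rewrite /rel_comp /=; split.
    by move=> [w [w' ? ?] ?]; exists w' => //; exists w.
  by move=> [w ? [w' ? ?]]; exists w' => //; exists w.
- move=> x y z; apply: lab_rel_inj.
  rewrite !Order.SetSubsetOrder.joinEsubset lab_relU !lab_rel_comp lab_relU.
  rewrite predeqE => -[u v]; rewrite /rel_comp /=; split.
    by move=> [w [?|?] ?]; [left|right]; exists w.
  by move=> [[w ? ?]|[w ? ?]]; exists w => //; [left|right].
- move=> x; apply: lab_rel_inj; rewrite lab_rel_comp lab_rel_id.
  rewrite predeqE => -[u v]; rewrite /rel_comp /diagonal /=; split.
    by move=> [w uw <-].
  by move=> uv; exists v.
- by [].
- by [].
- exact: lcompC.
- move=> x y.
  rewrite Order.SetSubsetOrder.leEsubset !Order.SetSubsetOrder.complEsubset.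
  apply/fintype.subsetP => a; have [u [v <-]] := lab_onto a.
  move=> uv; rewrite in_setC; apply/negP => vy.
  have : lab_rel (lcomp x (~: lcomp x y)) (u, v) by [].
  rewrite lab_rel_comp => -[w /= uw].
  rewrite lab_relC lab_rel_comp => -[_]; apply.
  by exists u => //; rewrite /lab_rel /= lab_sym.
Qed.

Lemma labelled_RRA : RRA L.
Proof.
split; first exact: labelled_relation_algebra.
exists U, classical_sets.setT, (range lab_rel); split.
  split.
  - by split.
  - by [].
  - exists [set: latom q n] => //; rewrite predeqE => x.
    by rewrite /lab_rel /= in_setT.
  - by move=> _ _ [X _ <-] [Y _ <-]; exists (X :|: Y) => //; rewrite lab_relU.
  - by move=> _ _ [X _ <-] [Y _ <-]; exists (X :&: Y) => //; rewrite lab_relI.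
  - by move=> _ [X _ <-]; exists (~: X) => //; rewrite lab_relC.
  - move=> _ _ [X _ <-] [Y _ <-].
    by exists (lcomp X Y) => //; rewrite lab_rel_comp.
  - by move=> _ [X _ <-]; exists X => //; rewrite lab_rel_conv.
  - by exists [set AId q n] => //; rewrite lab_rel_id.
exists lab_rel; split.
- split.
  + by move=> X _; exists X.
  + by move=> X Y _ _; exact: lab_rel_inj.
  + by move=> _ [X _ <-]; exists X.
- exact: lab_relU.
- exact: lab_relI.
- exact: lab_relC.
- exact: lab_rel_comp.
- by move=> x; rewrite lab_rel_conv.
- exact: lab_rel_id.
Qed.

End Labelling.

(** * Colourings that avoid a pattern *)

Section Colourings.
Variables (V : finType) (n : nat).
Local Notation colouring := {ffun V -> 'I_n}.

Definition avoiding (X : {set V}) (k : 'I_n) : {set colouring} :=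
  [set f : colouring | [forall (v | v \in X), f v != k]].

Lemma card_avoiding (X : {set V}) (k : 'I_n) :
  #|avoiding X k| = (n.-1 ^ #|X| * n ^ (#|V| - #|X|))%N.
Proof.
pose F (v : V) : pred 'I_n := if v \in X then predC1 k else predT.
transitivity #|(family F : simpl_pred colouring)|.
  rewrite cardsE; apply: eq_card => f; rewrite unfold_in /=.
  apply/forall_inP/familyP => fP v; last first.
    by move=> vX; have := fP v; rewrite /F vX.
  by rewrite /F; case: ifP => // vX; exact: fP.
rewrite card_family foldrE big_image /=.
rewrite (bigID (mem X)) /= -[in RHS](cardsC X) addKn -!prod_nat_const.
congr (_ * _)%N; apply: eq_big => // v; rewrite ?inE //.
  by move=> vX; rewrite /F vX cardC1 card_ord.
by move=> /negbTE vX; rewrite /F vX card_ord.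
Qed.

Definition pair_avoiding (S : {set V}) (s : V -> V) (k l : 'I_n) :
    {set colouring} :=
  [set f : colouring |
    [forall (v | v \in S), ~~ ((f v == k) && (f (s v) == l))]].

(** The pairs [(v, s v)] with [v] in [S] are disjoint, so the events
    [(f v, f (s v)) = (k, l)] are independent.  In terms of cardinals: group the
    values of [f] on each such pair into one value at [v], and put a dummy value
    at [s v]; the result ranges over a product of sets. *)
Lemma card_pair_avoiding (S : {set V}) (s : V -> V) (k l : 'I_n) :
    injective s -> [disjoint S & s @: S] ->
  (#|pair_avoiding S s k l| <=
    (n ^ 2).-1 ^ #|S| * n ^ (#|V| - #|S| - #|S|))%N.
Proof.
move=> s_inj dis.
have nS v : v \in S -> s v \in S = false.
  move=> vS; apply/negbTE/negP => svS.
  by have /pred0P/(_ (s v)) := dis; rewrite /= svS imset_f.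
pose F (v : V) : pred ('I_n * 'I_n) :=
  if v \in S then predC1 (k, l)
  else if v \in s @: S then pred1 (k, k) else [pred c | c.2 == k].
pose Phi (f : colouring) : {ffun V -> 'I_n * 'I_n} :=
  [ffun v => if v \in S then (f v, f (s v))
             else if v \in s @: S then (k, k) else (f v, k)].
have Phi_inj : injective Phi.
  move=> f g /ffunP e; apply/ffunP => v.
  have [vS|vS] := boolP (v \in S).
    by have := e v; rewrite !ffunE vS => -[].
  have [/imsetP[w wS ->]|vsS] := boolP (v \in s @: S).
    by have := e w; rewrite !ffunE wS => -[].
  by have := e v; rewrite !ffunE (negbTE vS) (negbTE vsS) => -[].
rewrite -(card_imset _ Phi_inj).
apply: (@leq_trans #|(family F : simpl_pred {ffun V -> 'I_n * 'I_n})|).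
  apply: subset_leq_card; apply/subsetP => _ /imsetP[f + ->].
  rewrite inE => /forall_inP fP; apply/familyP => v; rewrite ffunE /F.
  case: ifP => [vS|vS]; last by case: ifP => vsS; rewrite unfold_in /= eqxx.
  by have := fP v vS; rewrite unfold_in /= xpair_eqE.
rewrite card_family foldrE big_image /=.
rewrite (bigID (mem S)) /= leq_mul //.
  rewrite -prod_nat_const; apply: leq_prod => v vS.
  by rewrite /F vS cardC1 card_prod card_ord.
rewrite (bigID (mem (s @: S))) /=.
rewrite big1 ?mul1n => [|v /andP[/negbTE vS vsS]]; last first.
  by rewrite /F vS vsS card1.
have -> : (#|V| - #|S| - #|S|)%N = #|~: (S :|: s @: S)|.
  rewrite [RHS]cardsCs setCK; have [_ +] := leq_card_setU S (s @: S).
  by rewrite dis => /eqP ->; rewrite (card_imset _ s_inj) subnDA.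
rewrite -prod_nat_const; apply: eq_leq; apply: eq_big => v.
  by rewrite !inE negb_or.
move=> /andP[/negbTE vS /negbTE vsS]; rewrite /F vS vsS.
rewrite (eq_card (_ : _ =i [predX 'I_n & pred1 k])).
  by rewrite cardX card1 card_ord muln1.
by move=> [c c']; rewrite !inE.
Qed.
End Colourings.

(** * Directions in the affine plane over a finite field *)

Section Directions.
Variable F : finFieldType.
Local Notation plane := (F * F)%type.

(** The directions of the plane are the slopes in [F] and the vertical direction
    [None]; [vec i t] runs over the line of direction [i] through the origin. *)
Definition vec (i : option F) (t : F) : plane :=
  if i is Some m then (t, t * m) else (0, t).

Definition dir (d : plane) : option F :=
  if d.1 == 0 then None else Some (d.2 / d.1).

Lemma vecD i s t : vec i (s + t) = vec i s + vec i t.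
Proof.
by case: i => [m|] /=; rewrite -[RHS]/(_ + _, _ + _) /= ?mulrDl ?addr0.
Qed.

Lemma vec0 i : vec i 0 = 0.
Proof. by case: i => [m|] //=; rewrite mul0r. Qed.

Lemma vec_inj i : injective (vec i).
Proof. by case: i => [m|] s t []. Qed.

Lemma vec_eq0 i t : (vec i t == 0) = (t == 0).
Proof. by rewrite -(vec0 i) (inj_eq (@vec_inj i)). Qed.

Lemma dir_vec i t : t != 0 -> dir (vec i t) = i.
Proof.
by case: i => [m|] t0; rewrite /dir /= ?eqxx // (negbTE t0) mulrAC divff ?mul1r.
Qed.

Lemma vec_dir d : d != 0 -> exists2 t, t != 0 & d = vec (dir d) t.
Proof.
case: d => a b d0; rewrite /dir /=.
have [a0|a0] := eqVneq a 0.
  exists b; last by rewrite a0.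
  by apply: contraNneq d0 => b0; rewrite a0 b0.
by exists a => //=; rewrite mulrCA divff // mulr1.
Qed.

Lemma dirN d : dir (- d) = dir d.
Proof.
by case: d => a b; rewrite /dir /= oppr_eq0 invrN mulrNN.
Qed.

Lemma dirD_same d e : d != 0 -> e != 0 -> dir d = dir e -> d + e != 0 ->
  dir (d + e) = dir d.
Proof.
move=> /vec_dir[s s0 ds] /vec_dir[t t0 et] de.
rewrite ds et -de -vecD vec_eq0 => st0.
by rewrite !dir_vec.
Qed.

Lemma dirD_eql d e : d != 0 -> e != 0 -> d + e != 0 -> dir (d + e) = dir d ->
  dir e = dir d.
Proof.
move=> d0 e0 de0 de; rewrite -[e](addKr d) addrC dirD_same ?oppr_eq0 //.
  by rewrite dirN.
by rewrite addrC addKr.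
Qed.

Lemma dirD_diff d e : d != 0 -> e != 0 -> dir d != dir e ->
  [/\ d + e != 0, dir (d + e) != dir d & dir (d + e) != dir e].
Proof.
move=> d0 e0 de; have de0 : d + e != 0.
  by apply: contraNneq de => /eqP; rewrite addr_eq0 => /eqP ->; rewrite dirN.
split=> //.
  by apply: contraNneq de => /(dirD_eql d0 e0 de0) ->.
rewrite addrC; apply: contraNneq de => /dirD_eql ->//.
by rewrite addrC.
Qed.

Lemma vec_basis i j d : i != j -> exists s t, d = vec i s + vec j t.
Proof.
case: d => a b; case: i => [m|]; case: j => [m'|] // ij.
- have mm' : m - m' != 0 by rewrite subr_eq0; apply: contraNneq ij => ->.
  exists ((b - a * m') / (m - m')), (a - (b - a * m') / (m - m')).
  rewrite -[RHS]/(_ + _, _ + _) /=.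
  by congr pair; field.
- exists a, (b - a * m).
  by rewrite -[RHS]/(_ + _, _ + _) /=; congr pair; ring.
- exists (b - a * m'), a.
  by rewrite -[RHS]/(_ + _, _ + _) /=; congr pair; ring.
Qed.

End Directions.

(** * The labelling of two copies of the affine plane *)

Section PlaneLabelling.
Variables (F : finFieldType) (n : nat) (f : F * F -> 'I_n).
Local Notation plane := (F * F)%type.
Local Notation atom := (latom #|F| n).

Hypothesis card_F : (2 < #|F|)%N.
Hypothesis f_line : forall (v : plane) i k,
  exists2 t : F, t != 0 & f (v + vec i t) = k.
Hypothesis f_pair : forall (d : plane) k l, d != 0 ->
  exists2 w, f w = k & f (w + d) = l.

Definition dir_index (i : option F) : 'I_#|F|.+1 :=
  cast_ord (card_option F) (enum_rank i).

Lemma dir_index_inj : injective dir_index.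
Proof. by move=> i j /cast_ord_inj /enum_rank_inj. Qed.

Lemma dir_index_onto x : exists i, dir_index i = x.
Proof.
exists (enum_val (cast_ord (esym (card_option F)) x)).
by rewrite /dir_index enum_valK cast_ordKV.
Qed.

Definition plane_lab (u v : plane * bool) : atom :=
  if u.2 == v.2 then
    if u.1 == v.1 then AId _ _ else Aa _ (dir_index (dir (v.1 - u.1)))
  else At _ (f (u.1 + v.1)).

Lemma plane_lab_id u v : plane_lab u v = AId _ _ <-> u = v.
Proof.
case: u v => [x b] [y c]; rewrite /plane_lab /=.
split=> [|[-> ->]]; last by rewrite !eqxx.
by case: eqP => // -> ; case: eqP => // ->.
Qed.

Lemma plane_lab_sym u v : plane_lab u v = plane_lab v u.
Proof.
case: u v => [x b] [y c]; rewrite /plane_lab /= [c == b]eq_sym [y == x]eq_sym.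
by rewrite -[y - x]opprB dirN [y + x]addrC.
Qed.

Lemma plane_lab_onto a : exists u v, plane_lab u v = a.
Proof.
case: a => [|x|k].
- by exists (0, true), (0, true); apply/plane_lab_id.
- have [i <-] := dir_index_onto x; exists (0, true), (vec i 1, true).
  by rewrite /plane_lab /= eq_sym vec_eq0 oner_eq0 subr0 dir_vec ?oner_eq0.
- have [t _ tk] := f_line 0 None k; exists (0, true), (vec None t, false).
  by rewrite /plane_lab /= tk.
Qed.

Lemma Aa_lA x : (Aa n x \in lA #|F| n).
Proof. exact: imset_f. Qed.

Lemma At_lA k : (At #|F| k \in lA #|F| n) = false.
Proof. by apply/imsetP => -[]. Qed.

Lemma AId_lA : (AId #|F| n \in lA #|F| n) = false.
Proof. by apply/imsetP => -[]. Qed.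

Lemma At_lT k : (At #|F| k \in lT #|F| n).
Proof. exact: imset_f. Qed.

Lemma AId_lT : (AId #|F| n \in lT #|F| n) = false.
Proof. by apply/imsetP => -[]. Qed.

Lemma Aa_lT x : (Aa n x \in lT #|F| n) = false.
Proof. by apply/imsetP => -[]. Qed.

Definition atomE := (Aa_lA, At_lA, AId_lA, At_lT, AId_lT, Aa_lT).

Lemma latom_compC (a b : atom) : latom_comp a b = latom_comp b a.
Proof.
case: a b => [|i|k] [|j|l] //=;
  rewrite [j == i]eq_sym || rewrite [l == k]eq_sym.
  by case: eqP => [->|//]; rewrite finset.setUC.
by case: eqP.
Qed.

Lemma Aa_eq x y : (Aa n x == Aa n y :> atom) = (x == y).
Proof. by apply/eqP/eqP => [[]|->]. Qed.

Lemma plane_lab_sound u w v :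
  plane_lab u v \in latom_comp (plane_lab u w) (plane_lab w v).
Proof.
have labxx x : plane_lab x x = AId _ _ by apply/plane_lab_id.
have [->|uw] := eqVneq u w; first by rewrite labxx /= set11.
have [->|wv] := eqVneq w v; first by rewrite labxx latom_compC /= set11.
case: u w v uw wv => [x b] [z c] [y d]; rewrite /plane_lab /=.
rewrite !xpair_eqE.
have [->|bc] := eqVneq b c; have [cd|cd] := eqVneq c d;
  rewrite ?andbT ?eqxx ?andbF.
- move=> /= xz zy; rewrite (negbTE xz) (negbTE zy) /= (inj_eq dir_index_inj).
  have d0 : z - x != 0 by rewrite subr_eq0 eq_sym.
  have e0 : y - z != 0 by rewrite subr_eq0 eq_sym.
  have -> : y - x = (z - x) + (y - z) by rewrite [RHS]addrC addrA subrK.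
  have xyE : (x == y) = ((z - x) + (y - z) == 0).
    by rewrite [_ + (y - z)]addrC addrA subrK subr_eq0 eq_sym.
  rewrite xyE; have [de|de] := eqVneq (dir (z - x)) (dir (y - z)).
    by case: eqVneq => [_|de0]; rewrite ?set21 // dirD_same // set22.
  have [/negbTE -> dd ee] := dirD_diff d0 e0 de.
  by rewrite !inE Aa_lA !Aa_eq !(inj_eq dir_index_inj) negb_or dd.
- by move=> xz _; rewrite (negbTE xz) atomE.
- by move=> _ zy; rewrite (negbTE zy) -cd (negbTE bc) atomE.
- move=> _ _; have -> : b = d by move: b c d bc cd => [] [] [].
  rewrite eqxx /=; case: (eqVneq x y) => [->|xy].
    by rewrite [z + y]addrC eqxx !inE eqxx.
  by case: eqP; rewrite ?inE atomE.
Qed.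

Lemma plane_lab_dir (x : plane) (b : bool) i t : t != 0 ->
  plane_lab (x, b) (x + vec i t, b) = Aa _ (dir_index i).
Proof.
move=> t0; rewrite /plane_lab /= eqxx -subr_eq0 opprD addrA subrr sub0r.
by rewrite oppr_eq0 vec_eq0 (negbTE t0) addrC addrA addNr add0r dir_vec.
Qed.

(** For equal directions the intermediate point is another point of the line;
    for different ones the directions [i'], [j'] span the plane, and the two
    components of [y - x] are nonzero because its direction is neither. *)
Lemma saturated_aa i j u v :
  plane_lab u v \in latom_comp (Aa n i) (Aa n j) ->
  exists2 w, plane_lab u w = Aa n i & plane_lab w v = Aa n j.
Proof.
have [i' <-] := dir_index_onto i; have [j' <-] := dir_index_onto j.
case: u v => [x b] [y c]; rewrite /= (inj_eq dir_index_inj).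
have [->{b}|bc] := eqVneq b c; last first.
  rewrite /plane_lab /= (negbTE bc); case: ifP => _; rewrite !inE ?atomE //.
have [->{i'}|ij] := eqVneq i' j'.
  have [-> _|xy] := eqVneq x y.
    have e := plane_lab_dir y c j' (oner_neq0 F).
    by exists (y + vec j' 1, c); rewrite // plane_lab_sym.
  rewrite /plane_lab /= eqxx (negbTE xy) !inE /= Aa_eq (inj_eq dir_index_inj).
  have yx0 : y - x != 0 by rewrite subr_eq0 eq_sym.
  have [t t0 yx] := vec_dir yx0 => /eqP dj; rewrite dj in yx.
  (* A third point on the line, which is where [2 < #|F|] is needed. *)
  have /card_gt0P[s] : (0 < #|~: [set 0%R; t]|)%N.
    move: card_F; rewrite -(cardsC [set 0%R; t]) cards2.
    by case: (_ != _); case: #|_|.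
  rewrite !inE negb_or => /andP[s0 st].
  exists (x + vec j' s, c); first exact: plane_lab_dir.
  have -> : y = (x + vec j' s) + vec j' (t - s).
    by rewrite -addrA -vecD addrCA subrr addr0 -yx addrC subrK.
  by apply: plane_lab_dir; rewrite subr_eq0 eq_sym.
rewrite /plane_lab /= eqxx.
case: (eqVneq x y) => [_|xy]; first by rewrite !inE atomE.
rewrite !inE /= !Aa_eq !(inj_eq dir_index_inj) negb_or => /and3P[_ di dj].
have [s [t yx]] := vec_basis (y - x) ij.
have yx0 : y - x != 0 by rewrite subr_eq0 eq_sym.
have s0 : s != 0.
  apply: contraNneq dj => s0; rewrite yx s0 vec0 add0r dir_vec //.
  by apply: contraNneq yx0 => t0; rewrite yx s0 t0 !vec0 addr0.
have t0 : t != 0.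
  by apply: contraNneq di => t0; rewrite yx t0 vec0 addr0 dir_vec.
exists (x + vec i' s, c); first exact: plane_lab_dir.
have -> : y = (x + vec i' s) + vec j' t by rewrite -addrA -yx addrC subrK.
exact: plane_lab_dir.
Qed.

Lemma saturated_at i k u v :
  plane_lab u v \in latom_comp (Aa n i) (At _ k) ->
  exists2 w, plane_lab u w = Aa n i & plane_lab w v = At _ k.
Proof.
have [i' <-] := dir_index_onto i.
case: u v => [x b] [y c]; rewrite /plane_lab /=.
case: (eqVneq b c) => [_|bc _]; first by case: ifP; rewrite atomE.
have [t t0 tk] := f_line (x + y) i' k.
exists (x + vec i' t, b); first exact: plane_lab_dir.
by rewrite /plane_lab /= (negbTE bc) addrAC tk.
Qed.

Lemma saturated_tt k l u v :
  plane_lab u v \in latom_comp (At _ k) (At _ l) ->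
  exists2 w, plane_lab u w = At _ k & plane_lab w v = At _ l.
Proof.
case: u v => [x b] [y c]; rewrite /plane_lab /=.
have [->{b}|bc] := eqVneq b c; last by case: ifP; rewrite ?inE atomE.
have cN : (c == ~~ c) = false by case: (c).
have Nc : (~~ c == c) = false by case: (c).
case: (eqVneq x y) => [-> |xy _].
  case: eqVneq => [-> _|_]; last by rewrite atomE.
  have [t _ tl] := f_line (y + y) None l.
  exists (y + vec None t, ~~ c); rewrite /= ?cN ?Nc; first by rewrite addrA tl.
  by rewrite addrAC tl.
have [w wk wl] : exists2 w, f w = k & f (w + (y - x)) = l.
  by apply: f_pair; rewrite subr_eq0 eq_sym.
exists (w - x, ~~ c); rewrite /= ?cN ?Nc; first by rewrite addrC subrK wk.
by rewrite -addrA [- x + y]addrC wl.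
Qed.

Lemma plane_lab_saturated (a b : atom) u v :
  plane_lab u v \in latom_comp a b ->
  exists2 w, plane_lab u w = a & plane_lab w v = b.
Proof.
case: a b => [|i|k].
- by move=> b; rewrite /= inE => /eqP <-; exists u => //; apply/plane_lab_id.
- case=> [|j|l].
  + by rewrite /= inE => /eqP <-; exists v => //; apply/plane_lab_id.
  + exact: saturated_aa.
  + exact: saturated_at.
- case=> [|j|l].
  + by rewrite /= inE => /eqP <-; exists v => //; apply/plane_lab_id.
  + rewrite latom_compC plane_lab_sym => /saturated_at[w vw wu].
    by exists w; rewrite plane_lab_sym.
  + exact: saturated_tt.
Qed.

Lemma plane_RRA : RRA (Lqn #|F| n).
Proof.
apply: (@labelled_RRA _ _ _ plane_lab).
- exact: plane_lab_id.
- exact: plane_lab_sym.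
- exact: plane_lab_onto.
- move=> a b u v; split; first exact: plane_lab_saturated.
  by move=> [w <- <-]; exact: plane_lab_sound.
Qed.
End PlaneLabelling.

(** * A random colouring satisfies the two conditions *)

(** A maximal [S] disjoint from its image works: any point outside [S], [s @: S]
    and [s @^-1: S] could be added to it. *)
Lemma large_disjoint_image (V : finType) (s : V -> V) :
    injective s -> (forall v, s v != v) ->
  exists2 S : {set V}, [disjoint S & s @: S] & (#|V| <= 3 * #|S|)%N.
Proof.
move=> s_inj s_fix; pose P (S : {set V}) := [disjoint S & s @: S].
have P0 : P set0 by rewrite /P -setI_eq0 set0I.
case: (arg_maxnP (fun S : {set V} => #|S|) P0) => S PS Smax.
exists S => //; rewrite -cardsT.
apply: (@leq_trans #|S :|: s @: S :|: s @^-1: S|).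
  apply: subset_leq_card; apply/subsetP => v _; apply: contraT.
  rewrite !inE !negb_or => /andP[/andP[vS vsS] svS].
  suff /Smax : P (v |: S) by rewrite /geq /= cardsU1 vS ltnn.
  apply/pred0P => u /=; apply/negbTE; apply/negP.
  case/andP => /setU1P[->|uS] /imsetP[w /setU1P[->|wS] e].
  - by have := s_fix v; rewrite -e eqxx.
  - by case/negP: vsS; apply/imsetP; exists w.
  - by case/negP: svS; rewrite -e.
  - by have /pred0P/(_ u) := PS; rewrite /= uS e imset_f.
rewrite !mulSn mul0n addn0 addnA.
apply: (leq_trans (leq_card_setU _ _)); apply: leq_add.
  by apply: (leq_trans (leq_card_setU _ _)); rewrite leq_add2l leq_imset_card.
by rewrite card_preimset.
Qed.

Lemma union_bound (R : realFieldType) (T I : finType) (B : I -> {set T})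
    (p : I -> R) :
    (forall i, #|B i|%:R <= p i * #|T|%:R) -> \sum_i p i < 1 ->
    (0 < #|T|)%N ->
  exists f, forall i, f \notin B i.
Proof.
move=> Bp p1 T0.
suff /set0Pn[f fB] : (~: \bigcup_i B i)%SET != set0.
  exists f => i; apply: contraTN fB => fi; rewrite inE negbK.
  by apply/bigcupP; exists i.
rewrite -card_gt0 -(ltn_add2l #|\bigcup_i B i|) addn0 cardsC -(ltr_nat R).
apply: le_lt_trans (_ : (\sum_i p i) * #|T|%:R < _); last first.
  by rewrite gtr_pMl // ltr0n.
apply: (@le_trans _ _ (\sum_i #|B i|)%:R).
  rewrite ler_nat; elim/big_rec2: _ => [|i m A _ le_Am].
    by rewrite cards0.
  by apply: (leq_trans (leq_card_setU _ _)); rewrite leq_add2l.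
by rewrite natr_sum mulr_suml; apply: ler_sum => i _; exact: Bp.
Qed.

(** Turns the cardinals of the avoiding sets into probabilities. *)
Lemma natr_pred_frac (R : realFieldType) (a x y : nat) : (0 < a)%N ->
  (a.-1 ^ x * a ^ y)%:R = (1 - a%:R^-1) ^+ x * (a ^ (x + y))%:R :> R.
Proof.
move=> a0; have A0 : a%:R != 0 :> R by rewrite pnatr_eq0 -lt0n.
rewrite natrM !natrX exprD mulrA -exprMn mulrBl mul1r mulVf //.
by rewrite -subn1 natrB.
Qed.

Section GoodColouring.
Variables (R : realFieldType) (F : finFieldType) (n : nat) (p : R).
Local Notation plane := (F * F)%type.
Local Notation q := #|F|.
Hypothesis n0 : (0 < n)%N.
(* [p] bounds the failure probability of a condition on pairs of points. *)
Hypothesis p_pair :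
  forall s, (q ^ 2 <= 3 * s)%N -> (1 - (n%:R ^+ 2)^-1) ^+ s <= p.
Hypothesis small :
  (q ^ 2 * q.+1 * n)%:R * (1 - n%:R^-1) ^+ q.-1 + (q ^ 2 * n ^ 2)%:R * p < 1
  :> R.

Definition translate (d w : plane) : plane := w + d.

Lemma translate_inj d : injective (translate d).
Proof. exact: addIr. Qed.

Definition punctured_line (v : plane) (i : option F) : {set plane} :=
  [set v + vec i t | t in [set~ 0]].

Lemma card_punctured_line v i : #|punctured_line v i| = q.-1.
Proof.
rewrite card_imset ?cardsC1 // => s t /addrI; exact: vec_inj.
Qed.

Lemma good_colouring_exists :
  exists f : {ffun plane -> 'I_n},
    (forall (v : plane) i k, exists2 t : F, t != 0 & f (v + vec i t) = k) /\
    (forall (d : plane) k l, d != 0 -> exists2 w, f w = k & f (w + d) = l).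
Proof.
(* The identity has no such [S]; at [d = 0] the choice takes a default value. *)
have /fin_all_exists[S SP] (d : plane) : exists S : {set plane}, d != 0 ->
    [disjoint S & translate d @: S] /\ (#|{: plane}| <= 3 * #|S|)%N.
  have [->|d0] := eqVneq d 0; first by exists set0.
  have [|v|S ? ?] := @large_disjoint_image {: plane} (translate d).
  - exact: translate_inj.
  - by rewrite /translate -subr_eq0 addrC addrA addNr add0r.
  - by exists S.
pose I1 := (plane * option F * 'I_n)%type.
pose I2 := (plane * 'I_n * 'I_n)%type.
pose B (e : I1 + I2) : {set {ffun plane -> 'I_n}} :=
  match e with
  | inl (v, i, k) => avoiding (punctured_line v i) k
  | inr (d, k, l) =>
      if d == 0 then set0 else pair_avoiding (S d) (translate d) k l
  end.
pose pr (e : I1 + I2) : R :=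
  match e with inl _ => (1 - n%:R^-1) ^+ q.-1 | inr _ => p end.
have card_plane : #|{: plane}| = (q ^ 2)%N by rewrite card_prod mulnn.
have q0 : (0 < q)%N by apply/card_gt0P; exists 0.
have cardT : #|{ffun plane -> 'I_n}| = (n ^ (q ^ 2))%N.
  by rewrite card_ffun card_ord card_plane.
have p0 : 0 <= p.
  apply: le_trans (p_pair (_ : (q ^ 2 <= 3 * q ^ 2)%N));
    last by rewrite leq_pmull.
  apply: exprn_ge0; rewrite subr_ge0 invf_le1 ?exprn_gt0 ?ltr0n //.
  by rewrite exprn_ege1 // ler1n.
have [||| f fB] := @union_bound R _ _ B pr.
- move=> [[[v i] k]|[[d k] l]] /=; rewrite cardT.
    rewrite card_avoiding card_punctured_line card_plane natr_pred_frac //.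
    rewrite subnKC // (leq_trans (leq_pred _)) //.
    by rewrite -mulnn leq_pmull.
  case: eqVneq => [_|d0]; first by rewrite cards0 mulr_ge0 ?ler0n.
  have [dis leS] := SP d d0.
  have le2S : (#|S d| + #|S d| <= q ^ 2)%N.
    have [_ +] := leq_card_setU (S d) (translate d @: S d).
    rewrite dis (card_imset _ (@translate_inj d)) => /eqP <-.
    by rewrite -card_plane max_card.
  apply: (@le_trans _ _
      ((n ^ 2).-1 ^ #|S d| * n ^ (q ^ 2 - #|S d| - #|S d|))%:R).
    by rewrite ler_nat -card_plane card_pair_avoiding //; exact: translate_inj.
  have -> : (n ^ q ^ 2 =
      (n ^ 2) ^ (#|S d| + 0) * n ^ (q ^ 2 - #|S d| - #|S d|))%N.
    by rewrite addn0 -expnM -expnD mul2n -addnn -subnDA subnKC.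
  rewrite !natrM mulrA ler_wpM2r ?ler0n //.
  have := natr_pred_frac R #|S d| 0 (_ : 0 < n ^ 2)%N.
  rewrite expn0 muln1 => -> //; last by rewrite expn_gt0 n0.
  by rewrite ler_wpM2r ?ler0n // natrX p_pair // -card_plane.
- rewrite big_sumType /= !sumr_const.
  rewrite -[X in X + _]mulr_natl -[X in _ + X]mulr_natl.
  rewrite !card_prod card_option card_ord mulnn.
  by rewrite -[(_ * n * n)%N]mulnA [(n * n)%N]mulnn.
- by rewrite cardT expn_gt0 n0.
exists f; split=> [v i k|d k l d0].
  have := fB (inl (v, i, k)); rewrite inE /= negb_forall => /existsP[u].
  rewrite negb_imply negbK => /andP[/imsetP[t t0 ->] /eqP fk].
  by exists t => //; move: t0; rewrite !inE.
have := fB (inr (d, k, l)).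
rewrite /= (negbTE d0) inE negb_forall => /existsP[w].
rewrite negb_imply negbK => /and3P[_ /eqP fk /eqP fl].
by exists w.
Qed.

End GoodColouring.

(** * Estimates *)

Lemma exprB_le_expR (R : realType) (x : R) k : x <= 1 ->
  (1 - x) ^+ k <= expR (- (k%:R * x)).
Proof.
move=> x1; rewrite -mulrN expRM_natl.
by apply: lerXn2r; rewrite ?nnegrE ?expR_ge0 ?subr_ge0 // expR_ge1Dx.
Qed.

Lemma RRA_of_small_failure (R : realType) (n q : nat) :
    prime_power q -> (3 <= n)%N -> (3 * n <= q)%N ->
    2 * n%:R * q%:R ^+ 3 * expR (- (q%:R / n%:R)) < 1 :> R ->
  RRA (Lqn q n).
Proof.
move=> [p [k [p_pr k0 ->{q}]]] n3 nq.
have [F _ Fq] := pPrimePowerField p_pr k0; rewrite -Fq in nq *.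
set q := #|F| in nq *; set P := expR _ => small.
have n3' : 3 <= n%:R :> R by rewrite ler_nat.
have nq' : 3 * n%:R <= q%:R :> R by rewrite -natrM ler_nat.
have P0 : 0 < P := expR_gt0 _.
have n0 : (0 < n)%N by lia.
have pair s : (q ^ 2 <= 3 * s)%N -> (1 - (n%:R ^+ 2)^-1) ^+ s <= P.
  move=> qs; apply: le_trans (exprB_le_expR _ _) _.
    by rewrite invf_le1 ?exprn_gt0 ?ltr0n // exprn_ege1 // ler1n.
  rewrite ler_expR lerN2 ler_pdivlMr ?exprn_gt0 ?ltr0n //.
  rewrite expr2 mulrA divfK; last by rewrite pnatr_eq0 -lt0n.
  rewrite -natrM ler_nat; nia.
(* The exponent [q - 1] instead of [q] costs a factor at most [3/2]. *)
have line : (1 - n%:R^-1) ^+ q.-1 <= 3 / 2 * P.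
  have inv3 : n%:R^-1 <= 3^-1 :> R.
    by rewrite lef_pV2 ?posrE //; lra.
  have : (1 - n%:R^-1) ^+ q <= P.
    apply: exprB_le_expR; lra.
  have -> : q = q.-1.+1 by rewrite prednK //; lia.
  rewrite exprS /=; set z := _ ^+ q.-1.
  have : 0 <= z by apply: exprn_ge0; lra.
  nra.
have [||f [f_line f_pair]] := @good_colouring_exists R F n P n0.
- exact: pair.
- rewrite -/q !natrM -[q.+1]addn1 natrD.
  set a := q%:R in small nq' *; set b := n%:R in small n3' nq' line *.
  set z := _ ^+ q.-1 in line *.
  have c0 : 0 <= a * a * b * P by rewrite !mulr_ge0 //; lra.
  have le1 : a * a * (a + 1) * b * z <= a * a * b * P * (5 / 3 * a).
    rewrite (_ : _ * z = a * a * b * ((a + 1) * z)); last by ring.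
    rewrite (_ : _ * (5 / 3 * a) = a * a * b * (5 / 3 * a * P)); last by ring.
    by rewrite ler_wpM2l ?mulr_ge0 //; nra.
  have le2 : a * a * (b * b) * P <= a * a * b * P * (a / 3).
    rewrite (_ : _ * P = a * a * b * P * b); last by ring.
    by rewrite ler_wpM2l //; lra.
  apply: le_lt_trans small; rewrite !exprS expr0 mulr1; nra.
apply: plane_RRA f_line f_pair; rewrite -/q; lia.
Qed.

(** The logarithm of [2 n q^3 exp(- q/n) = 2 n^4 s^3 exp(- s)], with [ln 2]
    replaced by [1]. *)
Lemma RRA_of_log_ineq (R : realType) (n q : nat) (s := q%:R / n%:R : R) :
    prime_power q -> (3 <= n)%N -> 3 <= s -> 1 + 4 * ln n%:R + 3 * ln s < s ->
  RRA (Lqn q n).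
Proof.
move=> q_pp n3 s3 h.
have n0 : 0 < n%:R :> R by rewrite ltr0n; lia.
apply: (@RRA_of_small_failure R) => //.
  by move: s3; rewrite ler_pdivlMr // -natrM ler_nat.
have -> : q%:R = n%:R * s by rewrite /s mulrC divfK // gt_eqF.
have -> : n%:R * s / n%:R = s by rewrite mulrC mulKf // gt_eqF.
have -> : n%:R = expR (ln n%:R) :> R by rewrite lnK.
have {1}-> : s = expR (ln s) by rewrite lnK // posrE; lra.
rewrite -expRD -expRM_natl.
apply: (@le_lt_trans _ _ (expR (1 + 4 * ln n%:R + 3 * ln s - s))); last first.
  rewrite expR_lt1; lra.
have -> : 1 + 4 * ln n%:R + 3 * ln s - s =
   1 + ln n%:R + 3%:R * (ln n%:R + ln s) + - s :> R by ring.
rewrite !expRD; do 3![rewrite ler_pM2r ?expR_gt0 //].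
have := expR_ge1Dx (1 : R); lra.
Qed.

(** A step of repeated squaring with rounding, so that the numerals in rational
    bounds for powers of [expR x] stay small. *)
Lemma le_expr_double (R : realType) (x : R) m (a c : R) :
  0 <= a -> c <= a * a -> a <= x ^+ m -> c <= x ^+ (m + m).
Proof.
by move=> a0 caa ax; rewrite exprD; apply: le_trans caa _; exact: ler_pM.
Qed.

Lemma expR1_ge (R : realType) : 13 / 5 <= expR 1 :> R.
Proof.
have -> : expR 1 = expR (1 / 16) ^+ 16 :> R.
  by rewrite -expRM_natl; congr expR; field.
have := expR_ge1Dx (1 / 16 : R); set x := expR _ => x1.
have x2 : 79 / 70 <= x ^+ 2 by apply: (le_expr_double (m := 1)) x1; lra.
have x4 : 14 / 11 <= x ^+ 4 by apply: (le_expr_double (m := 2)) x2; lra.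
have x8 : 21 / 13 <= x ^+ 8 by apply: (le_expr_double (m := 4)) x4; lra.
by apply: (le_expr_double (m := 8)) x8; lra.
Qed.

Lemma expR1_le (R : realType) : expR 1 <= 14 / 5 :> R.
Proof.
have -> : expR 1 = (expR (- (1 / 32)) ^+ 32)^-1 :> R.
  by rewrite -expRM_natl -expRN; congr expR; field.
have -> : 14 / 5 = (5 / 14)^-1 :> R by rewrite invf_div.
rewrite lef_pV2 ?posrE ?exprn_gt0 ?expR_gt0 //.
have := expR_ge1Dx (- (1 / 32) : R); set x := expR _ => x1.
have x2 : 61 / 65 <= x ^+ 2 by apply: (le_expr_double (m := 1)) x1; lra.
have x4 : 59 / 67 <= x ^+ 4 by apply: (le_expr_double (m := 2)) x2; lra.
have x8 : 31 / 40 <= x ^+ 8 by apply: (le_expr_double (m := 4)) x4; lra.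
have x16 : 3 / 5 <= x ^+ 16 by apply: (le_expr_double (m := 8)) x8; lra.
by apply: (le_expr_double (m := 16)) x16; lra.
Qed.

(** [exp 14 <= 18^5]: from [e <= 14/5] one gets [e^7 <= (21/5) 18^2], and
    [(21/5)^2 <= 18]. *)
Lemma ln18_ge (R : realType) : 14 / 5 <= ln 18 :> R.
Proof.
have e7 : expR 1 ^+ 7 <= 21 / 5 * 18 ^+ 2 :> R.
  apply: (@le_trans _ _ ((14 / 5) ^+ 7)); last by rewrite !exprS expr0; lra.
  by apply: lerXn2r; rewrite ?nnegrE ?expR_ge0 ?expR1_le //; lra.
have e14 : expR 14 <= 18 ^+ 5 :> R.
  have -> : 14 = 14%:R * 1 :> R by rewrite mulr1.
  rewrite expRM_natl (exprM _ 7 2).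
  apply: (@le_trans _ _ ((21 / 5 * 18 ^+ 2) ^+ 2)).
    apply: lerXn2r => //.
      by rewrite nnegrE exprn_ge0 // expR_ge0.
    by rewrite nnegrE mulr_ge0 ?exprn_ge0 //; lra.
  have a0 : 0 <= 18 ^+ 4 :> R by exact: exprn_ge0.
  by rewrite exprMn -exprM [leRHS]exprS ler_wpM2r // expr2; lra.
have := e14; rewrite -[18 ^+ 5]lnK ?posrE ?exprn_gt0 // ler_expR lnXn //.
by rewrite -mulr_natl; lra.
Qed.

Lemma RRA_cubic (R : realType) (n q : nat) : (18 <= n)%N -> prime_power q ->
  n%:R * ln (n%:R : R) ^+ 3 <= q%:R -> RRA (Lqn q n).
Proof.
move=> n18 q_pp nq.
have n0 : 0 < n%:R :> R by rewrite ltr0n; lia.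
have L28 : 14 / 5 <= ln (n%:R : R).
  apply: le_trans (ln18_ge R) _.
  by rewrite ler_ln ?posrE // ler_nat.
set L := ln _ in nq L28 *; pose s := q%:R / n%:R : R.
have Ls : L ^+ 3 <= s by rewrite ler_pdivlMr // mulrC.
have s0 : 0 < s by apply: lt_le_trans Ls; rewrite exprn_gt0 //; lra.
pose r := expR (ln s / 3).
have rs : r ^+ 3 = s by rewrite -expRM_natl mulrC divfK // lnK.
have Lr : L <= r.
  rewrite -(@ler_pXn2r _ 3) ?nnegrE ?expR_ge0 //; first by rewrite rs.
  by lra.
(* [e y <= exp y], with [13/5] for [e] and [y = ln r]. *)
have r_ln : 13 / 5 * (ln s / 3) <= r.
  have -> : r = expR 1 * expR (ln s / 3 - 1).
    by rewrite -expRD addrC subrK.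
  have := expR1_ge R; have := expR_ge1Dx (ln s / 3 - 1).
  have : 0 < expR (ln s / 3 - 1) by exact: expR_gt0.
  nra.
have r3 : 196 / 25 * r <= s.
  by rewrite -rs exprS mulrC ler_pM2l ?expR_gt0 // expr2; nra.
have n3 : (3 <= n)%N by lia.
have s3 : 3 <= s by lra.
by apply: (RRA_of_log_ineq q_pp n3 s3); rewrite -/s -/L; lra.
Qed.

Lemma RRA_asymptotic (R : realType) (eps : R) : 0 < eps ->
  exists N : nat, forall n q : nat, (N <= n)%N -> prime_power q ->
    n%:R * ln (n%:R : R) `^ (1 + eps) <= q%:R -> RRA (Lqn q n).
Proof.
move=> eps0; pose L0 : R := expR 6 + 8 `^ eps^-1.
(* [n >= exp L0] gives [(ln n)^eps >= 8], hence [s >= 8 ln n], and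
   [ln s >= 6], from where on [exp] dominates the linear terms in [ln s]. *)
exists (Num.truncn (expR L0)).+1 => n q Nn q_pp nq.
have n_ge : expR L0 <= n%:R.
  apply: ltW; apply: lt_le_trans (truncnS_gt _) _.
  by rewrite ler_nat.
have e6 : 64 <= expR 6 :> R.
  have -> : 6 = 6%:R * 1 :> R by rewrite mulr1.
  rewrite expRM_natl (_ : 64 = 2 ^+ 6); last by ring.
  apply: lerXn2r; rewrite ?nnegrE ?expR_ge0 //.
  by have := expR_ge1Dx (1 : R); lra.
have e8 : 0 <= (8 : R) `^ eps^-1 by exact: powR_ge0.
have n3 : (3 <= n)%N.
  rewrite -(ler_nat R); apply: le_trans n_ge.
  by have := expR_ge1Dx L0; rewrite /L0; lra.
have n0 : 0 < n%:R :> R by rewrite ltr0n; lia.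
have L_ge : L0 <= ln n%:R by rewrite -[L0]expRK ler_ln ?posrE ?expR_gt0.
set L := ln _ in nq L_ge.
have L6 : expR 6 <= L by move: L_ge; rewrite /L0; lra.
have Leps : 8 <= L `^ eps.
  have -> : 8 = (8 `^ eps^-1) `^ eps :> R.
    by rewrite -powRrM mulVf ?gt_eqF // powRr1.
  apply: ge0_ler_powR; rewrite ?nnegrE //; first exact: ltW.
    by lra.
  by move: L_ge; rewrite /L0; lra.
pose s := q%:R / n%:R : R.
have s8 : 8 * L <= s.
  rewrite ler_pdivlMr //; apply: le_trans nq.
  rewrite mulrC ler_pM2l // powRD; last first.
    by apply/implyP => _; apply: lt0r_neq0; lra.
  by rewrite powRr1; nra.
have s_ln : 6 <= ln s.
  by rewrite -[6]expRK ler_ln ?posrE ?expR_gt0; lra.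
have s_exp : 64 * (ln s - 5) <= s.
  have {2}-> : s = expR 6 * expR (ln s - 6).
    by rewrite -expRD addrC subrK lnK // posrE; lra.
  have := expR_ge1Dx (ln s - 6); nra.
have s3 : 3 <= s by lra.
by apply: (RRA_of_log_ineq q_pp n3 s3); rewrite -/s -/L; lra.
Qed.

Theorem theorem3 (R : realType) :
  (forall eps : R, 0 < eps ->
     exists N : nat, forall n q : nat, (N <= n)%N -> prime_power q ->
       n%:R * ln (n%:R : R) `^ (1 + eps) <= q%:R -> RRA (Lqn q n))
  /\
  (forall n q : nat, (18 <= n)%N -> prime_power q ->
     n%:R * ln (n%:R : R) ^+ 3 <= q%:R -> RRA (Lqn q n)).
Proof. by split; [exact: RRA_asymptotic | exact: RRA_cubic]. Qed.
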